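(* Let $F^{\rm nil}_{\mathbb{F}_2}$ be the nilpotent residual finiteness growth function of the free group $\mathbb{F}_2$ on two generators. Then $$\exp(n^{\delta})\preceq F^{\rm nil}_{\mathbb{F}_2}(n)\qquad\text{with}\qquad \delta=\frac{\log_2(1+\sqrt2)}{\log_2(3+\sqrt{17})-1}.$$
   Context: $\mathbb{F}_2$ is the free group on generators $a,b$, with word length with respect to $\{a,a^{-1},b,b^{-1}\}$. For $n\ge1$, $F^{\rm nil}_{\mathbb{F}_2}(n)$ is the smallest integer such that for every non-trivial element $w\in\mathbb{F}_2$ of length at most $n$ there exists a homomorphism from $\mathbb{F}_2$ to a finite nilpotent group of cardinality at most $F^{\rm nil}_{\mathbb{F}_2}(n)$ which does not map $w$ to the neutral element. For functions $f,g$ on the positive integers, $f(n)\preceq g(n)$ means that there is a constant $C$ (which may be taken to be a positive integer) such that $f(n)\le C\,g(Cn)$ for all $n$. *)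

(* Defs.v *)
From HB Require Import structures.
From mathcomp Require Import all_boot all_order all_algebra.
From mathcomp Require Import all_fingroup all_solvable.
From mathcomp Require Import boolp reals exp.

Set Implicit Arguments.
Unset Strict Implicit.
Unset Printing Implicit Defensive.

Import Order.TTheory GRing.Theory Num.Theory.

(* A letter is a pair (generator, sign): (false, _) is a, (true, _) is b, and
   the second component is true for an inverse letter. *)
Definition letter : Type := (bool * bool)%type.

Definition linv (l : letter) : letter := (l.1, ~~ l.2).

Lemma linvK : involutive linv.
Proof. by case=> g e; rewrite /linv /= negbK. Qed.

Definition reduced (s : seq letter) : bool :=
  sorted (fun l l' => l' != linv l) s.

(* Left multiplication of a reduced word by one letter. *)
Definition lcons (l : letter) (s : seq letter) : seq letter :=
  if s is l' :: s' then if l' == linv l then s' else l :: s else [:: l].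

Lemma reduced_behead l s : reduced (l :: s) -> reduced s.
Proof. exact: path_sorted. Qed.

Lemma lcons_reduced l s : reduced s -> reduced (lcons l s).
Proof.
case: s => [//|l' s] /= rs; case: ifP => [_|nl]; first exact: path_sorted rs.
by rewrite /= nl.
Qed.

Lemma lcons_foldr_reduced u v : reduced v -> reduced (foldr lcons v u).
Proof. by move=> rv; elim: u => //= l u; apply: lcons_reduced. Qed.

Lemma lcons_id l s : reduced (l :: s) -> lcons l s = l :: s.
Proof. by case: s => //= l' s /andP[/negbTE ->]. Qed.

Lemma lconsK l s : reduced s -> lcons l (lcons (linv l) s) = s.
Proof.
case: s => [_|l' s rs] /=; first by rewrite eqxx.
rewrite linvK; case: eqP => [<-|_]; last by rewrite /= eqxx.
exact: lcons_id.
Qed.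

Lemma lconsVK l s : reduced s -> lcons (linv l) (lcons l s) = s.
Proof. by move=> rs; rewrite -{2}[l]linvK lconsK. Qed.

Lemma foldr_lcons l s v : reduced v ->
  foldr lcons v (lcons l s) = lcons l (foldr lcons v s).
Proof.
move=> rv; case: s => //= l' s; case: eqP => //= ->.
by rewrite lconsK // lcons_foldr_reduced.
Qed.

Lemma foldr_lconsA u v w : reduced w ->
  foldr lcons w (foldr lcons v u) = foldr lcons (foldr lcons w v) u.
Proof. by move=> rw; elim: u => //= l u IH; rewrite foldr_lcons // IH. Qed.

Lemma foldr_lcons_nil s : reduced s -> foldr lcons [::] s = s.
Proof.
elim: s => //= l s IH rs; rewrite IH; first exact: lcons_id.
exact: path_sorted rs.
Qed.

(* The free group on a and b, as the group of reduced words. *)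
Record F2 : Type := Word { word : seq letter; _ : reduced word }.

HB.instance Definition _ := [isSub of F2 for word].
HB.instance Definition _ := [Choice of F2 by <:].

Definition F2_one : F2 := @Word [::] isT.

Definition F2_mul (u v : F2) : F2 :=
  Word (lcons_foldr_reduced (word u) (valP v)).

(* Reversing and inverting letters preserves reducedness; the normalisation
   below is therefore the identity, see word_F2_inv. *)
Definition F2_inv (u : F2) : F2 :=
  Word (@lcons_foldr_reduced (rev (map linv (word u))) [::] isT).

Lemma F2_mulA : associative F2_mul.
Proof. by move=> u v w; apply: val_inj; rewrite /= foldr_lconsA ?(valP w). Qed.

Lemma F2_mul1 : left_id F2_one F2_mul.
Proof. by move=> u; apply: val_inj. Qed.

Lemma F2_mulr1 : right_id F2_one F2_mul.
Proof. by move=> u; apply: val_inj; rewrite /= foldr_lcons_nil ?(valP u). Qed.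

Lemma F2_mulV : left_inverse F2_one F2_inv F2_mul.
Proof.
move=> [u ru]; apply: val_inj; rewrite /= foldr_lconsA //=.
elim: u ru => //= l u IH rlu; have ru := path_sorted rlu.
rewrite rev_cons -cats1 foldr_cat /=.
by rewrite linvK eqxx IH.
Qed.

Lemma F2_mulrV : right_inverse F2_one F2_inv F2_mul.
Proof.
move=> u; rewrite -[F2_mul _ _]F2_mul1 -{1}(F2_mulV (F2_inv u)).
by rewrite -F2_mulA [F2_mul (F2_inv u) _]F2_mulA F2_mulV F2_mul1 F2_mulV.
Qed.

HB.instance Definition _ :=
  isGroup.Build F2 F2_mulA F2_mul1 F2_mulr1 F2_mulV F2_mulrV.

Lemma word_F2_inv (u : F2) : word (u^-1)%g = rev (map linv (word u)).
Proof.
rewrite /= foldr_lcons_nil // /reduced rev_sorted sorted_map.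
apply: sub_sorted (valP u) => l l' /=; apply: contra => /eqP.
by rewrite linvK => <-; rewrite eqxx.
Qed.

Definition F2_letter (l : letter) : F2 := @Word [:: l] isT.

Definition F2_a : F2 := F2_letter (false, false).
Definition F2_b : F2 := F2_letter (true, false).

Lemma F2_letterE l : F2_letter l =
  let x := if l.1 then F2_b else F2_a in if l.2 then (x^-1)%g else x.
Proof. by case: l => -[] []; apply: val_inj. Qed.

Definition word_length (w : F2) : nat := size (word w).

Lemma size_lcons l s : (size (lcons l s) <= (size s).+1)%N.
Proof. by case: s => //= l' s; case: ifP => //= _; rewrite ltnW // ltnW. Qed.

Lemma word_prod_letter (s : seq letter) :
  word (\prod_(l <- s) F2_letter l)%g = foldr lcons [::] s.
Proof. by elim: s => [|l s IH]; rewrite ?big_nil // big_cons /= IH. Qed.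

(* word_length is the word length with respect to {a, a^-1, b, b^-1}. *)
Lemma word_lengthP (w : F2) (n : nat) :
  (word_length w <= n)%N <->
  exists2 s : seq letter, (size s <= n)%N & w = (\prod_(l <- s) F2_letter l)%g.
Proof.
split=> [wn|[s sn ->]].
  exists (word w) => //; apply: val_inj.
  by rewrite /= word_prod_letter foldr_lcons_nil ?(valP w).
apply: leq_trans sn; rewrite /word_length word_prod_letter.
elim: s => //= l s IH; apply: leq_trans (size_lcons _ _) _.
by rewrite ltnS.
Qed.

Definition letter_lift (G : groupType) (x y : G) (l : letter) : G :=
  let z := if l.1 then y else x in if l.2 then (z^-1)%g else z.

(* The homomorphism from the free group sending a to x and b to y. *)
Definition F2_lift (G : groupType) (x y : G) (w : F2) : G :=
  (\prod_(l <- word w) letter_lift x y l)%g.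

Lemma F2_lift_is_multiplicative (G : groupType) (x y : G) :
  {morph F2_lift x y : u v / (u * v)%g}.
Proof.
have liftV l : letter_lift x y (linv l) = ((letter_lift x y l)^-1)%g.
  by case: l => g [] //=; rewrite /letter_lift /= invgK.
move=> [u ru] [v rv]; rewrite /F2_lift /=.
elim: u {ru} => [|l u IH]; first by rewrite big_nil mul1g.
rewrite /= big_cons -mulgA -IH.
case: (foldr _ _ _) => [|l' s] /=; first by rewrite big_seq1 big_nil mulg1.
case: eqP => [->|_]; last by rewrite big_cons.
by rewrite big_cons liftV mulKVg.
Qed.

HB.instance Definition _ (G : groupType) (x y : G) :=
  isMultiplicative.Build F2 G (F2_lift x y) (F2_lift_is_multiplicative x y).

Lemma F2_lift_a (G : groupType) (x y : G) : F2_lift x y F2_a = x.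
Proof. by rewrite /F2_lift big_seq1. Qed.

Lemma F2_lift_b (G : groupType) (x y : G) : F2_lift x y F2_b = y.
Proof. by rewrite /F2_lift big_seq1. Qed.

(* F2 is residually (finite nilpotent): images in the lower unitriangular
   matrices over 'F_p, following Magnus. *)
Section Unitriangular.
Local Open Scope ring_scope.

Variables (p n : nat).
Hypothesis p_pr : prime p.
Let F := 'F_p.

Definition unitri (A : 'M[F]_n.+1) : bool :=
  is_trig_mx A && [forall i, A i i == 1].

Lemma unitriP (A : 'M[F]_n.+1) :
  reflect ((forall i j : 'I_n.+1, (i < j)%N -> A i j = 0) /\ forall i, A i i = 1)
          (unitri A).
Proof.
apply: (iffP andP) => [[/is_trig_mxP trigA /forallP diagA]|[trigA diagA]].
  by split=> // i; apply/eqP.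
by split; [apply/is_trig_mxP | apply/forallP => i; apply/eqP].
Qed.

Lemma unitri1 : unitri 1.
Proof.
apply/unitriP; split=> [i j ij|i]; rewrite !mxE ?eqxx //.
by rewrite -val_eqE ltn_eqF.
Qed.

Lemma unitriM A B : unitri A -> unitri B -> unitri (A * B).
Proof.
move=> /unitriP[tA dA] /unitriP[tB dB]; apply/unitriP; split=> [i j ij|i].
  rewrite mxE big1 // => k _; case: (ltnP i k) => [/tA ->|ki].
    by rewrite mul0r.
  by rewrite (tB k j) ?mulr0 // (leq_ltn_trans ki).
rewrite mxE (bigD1 i) //= dA dB mulr1 big1 ?addr0 // => k ki.
case: (ltngtP i k) => [/tA ->|/tB ->|/val_inj ik]; rewrite ?mul0r ?mulr0 //.
by rewrite ik eqxx in ki.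
Qed.

Lemma unitri_unit A : unitri A -> A \is a GRing.unit.
Proof.
move=> /andP[trigA /forallP diagA]; apply/(_ : A \in unitmx).
by rewrite unitmxE det_trig // big1 ?unitr1 // => i _; apply/eqP.
Qed.

Lemma unitri_expp A : unitri A -> A ^+ (p ^ n.+1) = 1.
Proof.
move=> /andP[trigA /forallP diagA].
have nilA : (A - 1) ^+ n.+1 = 0.
  have := Cayley_Hamilton A; rewrite char_poly_trig //.
  rewrite (eq_bigr (fun=> 'X - 1%:P)) => [|i _]; last by rewrite (eqP (diagA i)).
  by rewrite prodr_const card_ord rmorphXn rmorphB /= horner_mx_X horner_mx_C.
have chM : p \in [pchar 'M[F]_n.+1] by rewrite pchar_lalg pchar_Fp.
have frob m : A ^+ (p ^ m) - 1 = (A - 1) ^+ (p ^ m).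
  elim: m => [|m IH]; first by rewrite expn0 !expr1.
  rewrite expnSr !exprM -IH -(pFrobenius_autE chM (_ - _)).
  by rewrite pFrobenius_autB_comm ?pFrobenius_aut1 //; apply: commr1.
apply/eqP; rewrite -subr_eq0 frob.
have le_p : (n.+1 <= p ^ n.+1)%N by apply/ltnW/ltn_expl/prime_gt1.
by rewrite -(subnK le_p) exprD nilA mulr0.
Qed.

Definition UT : {set {unit 'M[F]_n.+1}} := [set u | unitri (val u)].

Lemma UT_group_set : group_set UT.
Proof.
apply/group_setP; split=> [|u v]; rewrite !inE ?unitri1 //.
exact: unitriM.
Qed.
Canonical UT_group := Group UT_group_set.

Lemma UT_pgroup : (p.-group UT)%g.
Proof.
apply/pgroupP => q q_pr /(Cauchy q_pr)[u Uu ordu].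
have : (#[u]%g %| p ^ n.+1)%N.
  rewrite order_dvdn; apply/eqP/val_inj.
  by rewrite FinRing.val_unitX unitri_expp //; rewrite inE in Uu.
by rewrite ordu Euclid_dvdX // dvdn_prime2 // => /andP[].
Qed.

Lemma UT_nil : nilpotent [set: subg_of UT_group].
Proof.
rewrite -(isog_nil (isog_subg UT_group)); exact: pgroup_nil UT_pgroup.
Qed.

Variable c0 : bool.

Definition Magnus_N (g : bool) : 'M[F]_n.+1 :=
  \matrix_(i, j) ((i == j.+1 :> nat) && (odd i (+) c0 == g))%:R.

Lemma Magnus_N_sq g : Magnus_N g * Magnus_N g = 0.
Proof.
apply/matrixP => i j; rewrite !mxE big1 // => k _; rewrite !mxE -natrM mulnb.
set b := _ && _; suff -> : b = false by [].
apply/negP => /andP[/andP[/eqP-> /eqP<-] /andP[_]] /=.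
by case: (odd k) (c0) => [] [].
Qed.

Lemma Magnus_unitri g : unitri (1 + Magnus_N g).
Proof.
apply/unitriP; split=> [i j ij|i]; rewrite !mxE.
  by rewrite -val_eqE !ltn_eqF ?addr0 // ltnW.
by rewrite eqxx ltn_eqF ?addr0.
Qed.

Definition Magnus_unit g : {unit 'M[F]_n.+1} :=
  FinRing.unit _ (unitri_unit (Magnus_unitri g)).

Lemma Magnus_UT g : Magnus_unit g \in UT_group.
Proof. by rewrite inE Magnus_unitri. Qed.

Definition Magnus_gen g : subg_of UT_group := subg UT_group (Magnus_unit g).

Definition Magnus_sg (l : letter) : F := if l.2 then -1 else 1.

Fixpoint Magnus_coef (s : seq letter) : nat -> F :=
  if s is l :: s' then fun j =>
    Magnus_coef s' j + Magnus_sg l *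
    (if (0 < j)%N && (odd j (+) c0 == l.1) then Magnus_coef s' j.-1 else 0)
  else fun j => (j == 0%N)%:R.

Lemma UT_valM (u v : subg_of UT_group) :
  val (val (u * v)%g) = val (val u) * val (val v).
Proof. by []. Qed.

Lemma UT_valV (u : subg_of UT_group) : val (val (u^-1)%g) = (val (val u))^-1.
Proof. by []. Qed.

Lemma Magnus_letter l :
  val (val (letter_lift (Magnus_gen false) (Magnus_gen true) l)) =
  1 + Magnus_sg l *: Magnus_N l.1.
Proof.
have genE g : val (val (Magnus_gen g)) = 1 + Magnus_N g.
  by rewrite /= subgK ?Magnus_UT.
have genVE g : val (val ((Magnus_gen g)^-1)%g) = 1 - Magnus_N g.
  rewrite UT_valV genE.
  apply: (mulrI (unitri_unit (Magnus_unitri g))).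
  rewrite divrr ?unitri_unit ?Magnus_unitri //.
  by rewrite mulrDl mul1r mulrBr mulr1 Magnus_N_sq subr0 subrK.
case: l => [] [] []; rewrite /letter_lift /Magnus_sg ?scaleN1r ?scale1r;
  by rewrite (genE, genVE).
Qed.

Lemma Magnus_coefE (s : seq letter) (i : 'I_n.+1) :
  val (val (\prod_(l <- s) letter_lift (Magnus_gen false) (Magnus_gen true) l)%g)
    i ord0 = Magnus_coef s i.
Proof.
elim: s i => [|l s IH] i; first by rewrite big_nil mxE -val_eqE.
rewrite big_cons UT_valM Magnus_letter mulrDl mul1r.
rewrite mxE IH /=; congr (_ + _); rewrite -scalerAl mxE; congr (_ * _).
rewrite mxE; case: i => [[|i] ltin] /=.
  by rewrite big1 // => k _; rewrite mxE mul0r.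
rewrite (bigD1 (Ordinal (ltnW ltin))) //= [X in _ + X]big1 => [|k ki].
  rewrite addr0 IH mxE /= eqxx /=; case: ifP; rewrite ?mul1r ?mul0r //.
rewrite mxE /= eqSS eq_sym; case: eqP => [ki'|]; last by rewrite mul0r.
by case/eqP: ki; apply: val_inj.
Qed.

Lemma Magnus_coef_neq0 l s : c0 = ~~ (last l s).1 -> reduced (l :: s) ->
  (size (l :: s) < p)%N -> exists2 m, (0 < m <= size (l :: s))%N &
    Magnus_coef (l :: s) m != 0.
Proof.
have sg_neq0 k : Magnus_sg k != 0.
  by rewrite /Magnus_sg; case: ifP; rewrite ?oppr_eq0 oner_eq0.
have nat_neq0 e : (0 < e < p)%N -> (e%:R : F) != 0.
  move=> /andP[e0 ep]; rewrite -(dvdn_pcharf (pchar_Fp p_pr)).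
  by rewrite gtnNdvd.
move=> c0E rs sp.
suff [m [e [/andP[/andP[m0 ms] /andP[e0 es]] _ _ ne0 eqm]]] : exists m e : nat,
  [/\ (0 < m <= size (l :: s))%N && (0 < e <= size (l :: s))%N,
      odd m (+) c0 = l.1, (forall j, (m < j)%N -> Magnus_coef (l :: s) j = 0),
      Magnus_coef (l :: s) m.-1 != 0 &
      Magnus_coef (l :: s) m =
        Magnus_sg l * e%:R * Magnus_coef (l :: s) m.-1].
  exists m; first by rewrite m0.
  by rewrite eqm !mulf_neq0 // nat_neq0 // e0 (leq_ltn_trans es).
elim: s l c0E rs sp => [|l' s IH] l c0E rs sp.
  exists 1%N, 1%N; split=> //=.
  - by rewrite c0E /=; case: l.1.
  - by move=> [|[|j]] // _; rewrite if_same mulr0 addr0.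
  - by rewrite mulr0 addr0 oner_eq0.
  - by rewrite c0E /=; case: l.1; rewrite /= !add0r mulr0 addr0 !mulr1.
have /andP[nll' rs'] : (l' != linv l) && reduced (l' :: s) by [].
have [m [e [/andP[/andP[m0 ms] /andP[e0 es]] cm z ne0 eqm]]] := IH l' c0E rs' (ltnW sp).
have coefS j : Magnus_coef [:: l, l' & s] j = Magnus_coef (l' :: s) j +
    Magnus_sg l * (if (0 < j)%N && (odd j (+) c0 == l.1)
                   then Magnus_coef (l' :: s) j.-1 else 0) by [].
have [ll'|nl] := boolP (l.1 == l'.1).
  have {nll' ll'}ll' : l = l'.
    by move: nll' ll'; case: (l) (l') => [[] []] [[] []].
  have eqpm : Magnus_coef [:: l, l' & s] m.-1 = Magnus_coef (l' :: s) m.-1.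
    rewrite coefS ll' -cm; case: m m0 {ms cm z ne0 eqm} => //= m _.
    have -> : (odd m (+) c0 == ~~ odd m (+) c0) = false.
      by case: (odd m) (c0) => [] [].
    by rewrite andbF mulr0 addr0.
  exists m, e.+1; split.
  - by rewrite m0 ltnW.
  - by rewrite ll'.
  - move=> j mj; rewrite coefS z // add0r.
    case: ifP => [|_]; last by rewrite mulr0.
    case/andP=> _ /eqP cj; rewrite z ?mulr0 //.
    case: j mj cj => //= j; rewrite ltnS leq_eqVlt => /orP[/eqP <-|//].
    by rewrite ll' -cm; case: (odd m) (c0) => [] [].
  - by rewrite eqpm.
  - rewrite eqpm coefS ll' m0 cm eqxx eqm.
    move: (Magnus_coef (l' :: s) m.-1) => V.
    by rewrite -[in RHS]natr1 mulrDr mulrDl mulr1.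
have nem : Magnus_coef (l' :: s) m != 0.
  by rewrite eqm !mulf_neq0 // nat_neq0 // e0 (leq_ltn_trans es) // ltnW.
have eqSm : Magnus_coef [:: l, l' & s] m = Magnus_coef (l' :: s) m.
  by rewrite coefS cm eq_sym (negbTE nl) andbF mulr0 addr0.
exists m.+1, 1%N; split.
- by rewrite /= ltnS ms.
- by rewrite /= addNb cm; move: nl; case: l.1 l'.1 => [] [].
- move=> j mj; rewrite coefS z ?(ltnW mj) // add0r.
  by rewrite z ?if_same ?mulr0 // -ltnS (ltn_predK mj).
- by rewrite /= -/(Magnus_coef [:: l, l' & s] m) eqSm.
- rewrite [m.+1.-1]/= eqSm coefS z // add0r [m.+1.-1]/= [odd _]/= addNb cm mulr1.
  by move: nl; case: l.1 l'.1 => [] [].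
Qed.

End Unitriangular.

(* The target group is the whole finite group type gT. A multiplicative map
   between groups preserves 1, so f is a group homomorphism. *)
Definition nil_detected (m : nat) (w : F2) : Prop :=
  exists (gT : finGroupType) (f : {multiplicative F2 -> gT}),
    [/\ nilpotent [set: gT], (#|[set: gT]| <= m)%N & f w <> 1%g].

Definition nil_bound (n m : nat) : Prop :=
  forall w : F2, w <> 1%g -> (word_length w <= n)%N -> nil_detected m w.

Lemma ex_nil_bound (n : nat) : exists m, `[< nil_bound n m >].
Proof.
have [p np p_pr] := prime_above n.
exists #|[set: subg_of (UT_group p n)]|; apply/asboolP => -[w rw] w1 wn.
case: w rw w1 wn => [|l s] rw w1 wn; first by case: w1; apply: val_inj.
pose c0 := ~~ (last l s).1.
exists (subg_of (UT_group p n)).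
exists (F2_lift (Magnus_gen p n c0 false) (Magnus_gen p n c0 true)).
split=> //; first exact: UT_nil.
have [|m /andP[m0 ms] nz f1] := Magnus_coef_neq0 p_pr (erefl c0) rw.
  exact: leq_ltn_trans np.
have ltm : (m < n.+1)%N by rewrite ltnS (leq_trans ms).
have := Magnus_coefE p c0 (l :: s) (Ordinal ltm).
rewrite -[X in val (val X)]/(F2_lift _ _ (Word rw)) f1 /= => E.
case/eqP: nz; rewrite /= -E mxE -val_eqE /=.
by case: (m) m0.
Qed.

(* The nilpotent residual finiteness growth function of F2. *)
Definition Fnil (n : nat) : nat := ex_minn (ex_nil_bound n).

Lemma Fnil_bound n : nil_bound n (Fnil n).
Proof. by rewrite /Fnil; case: ex_minnP => m /asboolP. Qed.

Lemma Fnil_min n m : nil_bound n m -> (Fnil n <= m)%N.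
Proof.
by move=> bm; rewrite /Fnil; case: ex_minnP => k _; apply; apply/asboolP.
Qed.

Section Growth.
Variable R : realType.
Local Open Scope ring_scope.

(* f and g stand for functions on the positive integers: their values at 0
   are not used. *)
Definition preceq (f g : nat -> R) : Prop :=
  exists2 C : nat, (0 < C)%N &
    forall n : nat, (0 < n)%N -> f n <= C%:R * g (C * n)%N.

Definition log2 (x : R) : R := ln x / ln 2.

Definition delta : R :=
  log2 (1 + Num.sqrt 2) / (log2 (3 + Num.sqrt 17) - 1).

End Growth.

(* Main.v *)
(* Starting from (a, b), iterate (a, b) |-> (b^-1 a b a^-1, a b a^-1 b^-1).
   The two new words are conjugate by b, hence agree modulo a deeper term of the
   lower central series: if a, b lie in the d-th term and a^-1 b in the e-th one,
   the new pair lies in the (d + e)-th term and its quotient in the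
   (2 d + e)-th one, so the depth grows like (1 + sqrt 2)^n. If a, b have length
   at most l and a b has length at most s, then the new bounds are 2 l + s and,
   thanks to a cancellation, 4 l + s, so the length grows like
   ((3 + sqrt 17) / 2)^n. No word of the sequence is trivial, because some pair
   in the alternating group of degree 5 is mapped by the iteration to a conjugate
   pair. Finally, a nilpotent group in which a word of depth d survives has a
   nontrivial d-th lower central term, hence at least 2^d elements. *)

Require Import Defs.
From mathcomp Require Import all_boot all_order all_algebra.
From mathcomp Require Import all_fingroup commutator nilpotent.
From mathcomp Require Import ring lra zify.
From mathcomp Require Import reals sequences exp.

Set Implicit Arguments.
Unset Strict Implicit.
Unset Printing Implicit Defensive.

Import Order.TTheory GRing.Theory Num.Theory.

(** * Commutators and orders in the lower central series *)

Section LowerCentralSeries.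
Local Open Scope group_scope.

Lemma three_subgroup_mod (gT : finGroupType) (G H K N : {group gT}) :
    G \subset 'N(N) -> H \subset 'N(N) -> K \subset 'N(N) ->
  [~: G, H, K] \subset N -> [~: H, K, G] \subset N -> [~: K, G, H] \subset N.
Proof.
have quo (A B C : {group gT}) : A \subset 'N(N) -> B \subset 'N(N) ->
    C \subset 'N(N) -> [~: A, B, C] \subset N <-> [~: A / N, B / N, C / N] :=: 1.
  move=> nA nB nC; have nAB : [~: A, B] \subset 'N(N).
    by rewrite (subset_trans (commg_sub _ _)) // join_subG nA.
  have nABC : [~: A, B, C] \subset 'N(N).
    by rewrite (subset_trans (commg_sub _ _)) // join_subG nAB.
  by rewrite -!quotientR // -(quotient_sub1 nABC); split=> [/trivgP | ->].
move=> nG nH nK /quo GHK /quo HKG; apply/quo => //.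
by apply: three_subgroup; [apply: GHK | apply: HKG].
Qed.

(** Induction on [n]: each term is a commutator of the previous one with [G], so the three subgroup
    lemma applies modulo the target. *)
Lemma lcn_comm (gT : finGroupType) (G : {group gT}) m n :
  [~: 'L_m(G), 'L_n(G)] \subset 'L_(m + n)(G).
Proof.
elim: n m => [|[|n] IHn] m.
- by rewrite addn0 commg_subl (subset_trans _ (lcn_norm m G)) ?lcn_sub.
- by rewrite addn1; apply: lcnSnS.
have nN k : 'L_k(G) \subset 'N('L_(m + n.+2)(G)).
  exact: subset_trans (lcn_sub k G) (lcn_norm _ G).
rewrite lcnSn commGC; apply: three_subgroup_mod; [exact: lcn_norm| exact: nN| exact: nN| |].
  apply: subset_trans (commSg _ _) _; first by rewrite commGC; apply: lcnSnS.
  by rewrite -addSnnS; apply: IHn.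
apply: subset_trans (commSg _ (IHn m)) _.
by rewrite (addnS m n.+1); apply: lcnSnS.
Qed.

Lemma mem_lcn_comm (gT : finGroupType) (G : {group gT}) m n x y :
  x \in 'L_m(G) -> y \in 'L_n(G) -> [~ x, y] \in 'L_(m + n)(G).
Proof. by move=> Lx Ly; apply/(subsetP (lcn_comm G m n))/mem_commg. Qed.

(** The series decreases strictly down to ['L_d(G)]: [d - 1] inclusions of index at least 2, and a
    last factor 2 from ['L_d(G)] itself. *)
Lemma leq_exp2_nilpotent (gT : finGroupType) (G : {group gT}) d :
  nilpotent G -> 'L_d(G) :!=: 1 -> 2 ^ d <= #|G|.
Proof.
move=> nilG ntL.
suff: 2 ^ d.-1 * #|'L_d(G)| <= #|G|.
  apply: leq_trans; case: d ntL => [|d] ntL; first by rewrite mul1n cardG_gt0.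
  by rewrite expnSr leq_mul2l (cardG_gt1 'L_d.+1(G)) ntL orbT.
case: d ntL => [|d] ntL; first by rewrite mul1n.
elim: d ntL => [|d IHd] ntL; first by rewrite mul1n.
have ntLd : 'L_d.+1(G) :!=: 1.
  by apply: contraNneq ntL => Ld; rewrite -subG1 -Ld lcn_subS.
apply: leq_trans (IHd ntLd); rewrite /= expnSr -mulnA leq_mul2l; apply/orP; right.
have prL : 'L_d.+2(G) \proper 'L_d.+1(G).
  by rewrite lcnSn (nil_comm_properl nilG) ?lcn_sub // subsetI subxx lcn_norm.
have := LagrangeI ('L_d.+1(G))%G ('L_d.+2(G))%G.
rewrite (setIidPr (lcn_subS _ _)) => <-.
rewrite mulnC leq_mul2l; apply/orP; right.
by rewrite indexg_gt1; case/andP: prL.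
Qed.

End LowerCentralSeries.

(** * The commutator iteration: equivariance and depth *)

Section CommutatorStep.
Local Open Scope group_scope.

Definition comm_step (G : groupType) (p : G * G) : G * G :=
  (p.2^-1 * p.1 * p.2 * p.1^-1, p.1 * p.2 * p.1^-1 * p.2^-1).

Lemma comm_step_morph (G H : groupType) (f : {multiplicative G -> H}) n p :
  iter n (@comm_step H) (f p.1, f p.2) =
  (f (iter n (@comm_step G) p).1, f (iter n (@comm_step G) p).2).
Proof.
have f1 : f 1 = 1 by apply: (mulgI (f 1)); rewrite -gmulfM !mulg1.
have fV x : f x^-1 = (f x)^-1 by apply: (mulgI (f x)); rewrite -gmulfM !mulgV.
elim: n => //= n ->; set q := iter _ _ _.
by rewrite /comm_step /= !gmulfM !fV.
Qed.

Lemma comm_step_conj (G : groupType) (x y g : G) n :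
  comm_step (x, y) = (x ^ g, y ^ g) ->
  iter n (@comm_step G) (x, y) = (x ^ (g ^+ n), y ^ (g ^+ n)).
Proof.
have stepJ u v h : comm_step (u ^ h, v ^ h) =
    ((comm_step (u, v)).1 ^ h, (comm_step (u, v)).2 ^ h).
  by rewrite /comm_step /= !conjMg !conjVg.
move=> xyg; elim: n => [|n IHn]; first by rewrite expg0 !conjg1.
by rewrite iterS IHn stepJ xyg /= -!conjgM -expgS.
Qed.

Fixpoint comm_depth (n : nat) : nat * nat :=
  if n is n'.+1 then
    let: (d, e) := comm_depth n' in (d + e, d + (d + e))
  else (1%N, 1%N).

Lemma comm_step_lcn (gT : finGroupType) (x y : gT) n :
  let G := [set: gT] in let p := iter n (@comm_step gT) (x, y) in
  let: (d, e) := comm_depth n in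
  [/\ p.1 \in 'L_d(G), p.2 \in 'L_d(G) & p.1^-1 * p.2 \in 'L_e(G)].
Proof.
move=> G; elim: n => [|n /=]; first by rewrite /= lcn1 !inE.
case: (comm_depth n) => d e; move: (iter _ _ _) => [a b] /= [La Lb Lab].
have Lconj k z h : z \in 'L_k(G) -> z ^ h \in 'L_k(G).
  by move=> Lz; rewrite memJ_norm // (subsetP (lcn_norm k G)) ?inE.
have Lb' : a * b * a^-1 * b^-1 \in 'L_(d + e)(G).
  (* Up to conjugacy and inverses, commuting [a] with [b] is commuting [a] with [a^-1 * b], which
     lies in ['L_e(G)]. *)
  have -> : a * b * a^-1 * b^-1 = [~ a^-1, (a^-1 * b)^-1] ^ a^-1.
    by rewrite /commg /conjg !invMg !invgK !mulgA !mulgK.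
  by apply/Lconj/mem_lcn_comm; rewrite groupV.
have La' : b^-1 * a * b * a^-1 \in 'L_(d + e)(G).
  have -> : b^-1 * a * b * a^-1 = (a * b * a^-1 * b^-1) ^ b.
    by rewrite /conjg !mulgA mulgKV.
  exact: Lconj.
split=> //; rewrite [d + (d + e)]addnC.
have -> : (b^-1 * a * b * a^-1)^-1 * (a * b * a^-1 * b^-1) =
    [~ b^-1 * a * b * a^-1, b^-1].
  by rewrite /commg /conjg invgK; congr (_ * _); rewrite !mulgA mulgV mul1g.
by apply: mem_lcn_comm; rewrite // groupV.
Qed.

End CommutatorStep.

(** * Word length of the iterates *)

Section Length.
Local Open Scope group_scope.

Lemma word_lengthM (u v : F2) :
  word_length (u * v) <= word_length u + word_length v.
Proof.
have [[s su Es] [t tv Et]] := ((word_lengthP u _).1 (leqnn _),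
                               (word_lengthP v _).1 (leqnn _)).
apply/word_lengthP; exists (s ++ t); first by rewrite size_cat leq_add.
by rewrite big_cat -Es -Et.
Qed.

Lemma word_lengthV (u : F2) : word_length u^-1 = word_length u.
Proof. by rewrite /word_length word_F2_inv size_rev size_map. Qed.

(** Bounds for both words and for their product; the sums stay unsimplified to match the factors one
    by one. *)
Fixpoint comm_length (n : nat) : nat * nat :=
  if n is n'.+1 then
    let: (l, s) := comm_length n' in (l + s + l, l + s + l + l + l)
  else (1%N, 2%N).

Definition comm_word (n : nat) : F2 * F2 :=
  iter n (@comm_step F2) (F2_a, F2_b).

(* Each of the commutators [b^-1 a b a^-1] and [a b a^-1 b^-1] contains the
   block [a b], whose length is estimated separately; in their product
   [a^-1 a] cancels. *)
Lemma comm_word_length n : let p := comm_word n in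
  let: (l, s) := comm_length n in
  [/\ word_length p.1 <= l, word_length p.2 <= l &
      word_length (p.1 * p.2) <= s].
Proof.
elim: n => [|n] //; rewrite [comm_word n.+1]/comm_word iterS -/(comm_word n) /=.
case: (comm_length n) (comm_word n) => l s [a b] /= [la lb lab].
have mulL u v k k' : word_length u <= k -> word_length v <= k' ->
    word_length (u * v) <= k + k'.
  by move=> uk vk'; apply: leq_trans (word_lengthM u v) (leq_add uk vk').
have lVa : word_length a^-1 <= l by rewrite word_lengthV.
have lVb : word_length b^-1 <= l by rewrite word_lengthV.
split.
- by rewrite -(mulgA b^-1); do !apply: (mulL).
- by rewrite [(l + s)%N]addnC; do !apply: (mulL).
- have -> : b^-1 * a * b * a^-1 * (a * b * a^-1 * b^-1) =
      b^-1 * (a * b) * b * a^-1 * b^-1.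
    by rewrite !mulgA mulgKV.
  by do !apply: (mulL).
Qed.

End Length.

(** * Non-triviality through permutations of five points *)

Section NonTrivial.
Local Open Scope group_scope.

Lemma perm5_of_uniq (s : seq nat) :
  uniq s -> size s = 5 -> all (ltn^~ 5) s ->
  {g : {perm 'I_5} | forall i, g i = nth 0 s i :> nat}.
Proof.
move=> us ss as5.
have f_inj : injective (fun i : 'I_5 => @inord 4 (nth 0 s i)).
  move=> i j /(congr1 val); rewrite /= !inordK.
  - by move=> /eqP; rewrite nth_uniq ?ss // => /eqP/val_inj.
  - by apply: (allP as5); rewrite mem_nth ?ss.
  - by apply: (allP as5); rewrite mem_nth ?ss.
exists (perm f_inj) => i; rewrite permE /= inordK //.
by apply: (allP as5); rewrite mem_nth ?ss.
Qed.

(* Found by a computer search. Here [x] and [y] generate the alternating group,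
   and since [comm_step] acts on [(x, y)] as conjugation by [g], its iterates
   never become trivial. *)
Lemma comm_step_perm5 : exists x y g : {perm 'I_5},
  x <> 1 /\ comm_step (x, y) = (x ^ g, y ^ g).
Proof.
have [//|//|//|x xE] := @perm5_of_uniq [:: 1; 2; 3; 4; 0]%N.
have [//|//|//|y yE] := @perm5_of_uniq [:: 2; 0; 4; 1; 3]%N.
have [//|//|//|g gE] := @perm5_of_uniq [:: 1; 2; 4; 0; 3]%N.
(* [u] and [v] are the tables of [x ^ g] and [y ^ g]. *)
have [//|//|//|u uE] := @perm5_of_uniq [:: 3; 2; 4; 1; 0]%N.
have [//|//|//|v vE] := @perm5_of_uniq [:: 2; 4; 1; 0; 3]%N.
exists x, y, g; split.
  by move=> /permP/(_ ord0)/(congr1 (@nat_of_ord 5)); rewrite xE perm1.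
have [xg yg] : g * u = x * g /\ g * v = y * g.
  by split; apply/permP=> i; apply: ord_inj; rewrite !permM !(xE, yE, gE, uE, vE);
    case: i => [[|[|[|[|[|]]]]]].
(* The equations of [comm_step] with inverses cleared, checked pointwise. *)
have [xy yx] : y * u * x = x * y /\ v * y * x = x * y.
  by split; apply/permP=> i; apply: ord_inj; rewrite !permM !(xE, yE, gE, uE, vE);
    case: i => [[|[|[|[|[|]]]]]].
rewrite /conjg -xg -yg !mulKg /comm_step /=; congr (_, _).
- by rewrite -(mulgA y^-1) -xy -!mulgA mulKg mulgV mulg1.
- by rewrite -yx !mulgK.
Qed.

(** The homomorphism sending the generators to [x] and [y] maps this word to a conjugate of [x]. *)
Lemma comm_word_neq1 n : (comm_word n).1 <> 1.
Proof.
have [x [y [g [x1 xyg]]]] := comm_step_perm5.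
have := comm_step_morph (F2_lift x y) n (F2_a, F2_b).
rewrite /= F2_lift_a F2_lift_b (comm_step_conj _ xyg).
rewrite -/(comm_word n) => -[+ _] w1; rewrite w1 [F2_lift x y 1]big_nil => xg1.
by apply: x1; apply: (conjg_inj (g ^+ n)); rewrite xg1 conj1g.
Qed.

End NonTrivial.

(** * Lower bound for the growth function along the words *)

Local Open Scope ring_scope.

Lemma leq_exp2_Fnil (k n : nat) :
  ((comm_length k).1 <= n -> 2 ^ (comm_depth k).1 <= Fnil n)%N.
Proof.
move=> len; have wn : (word_length (comm_word k).1 <= n)%N.
  by apply: leq_trans len; have := comm_word_length k; case: comm_length => l s [].
have [gT [f [nilG /(leq_trans _) leG fw]]] := Fnil_bound (@comm_word_neq1 k) wn.
apply/leG/leq_exp2_nilpotent => //; apply: contra_not_neq fw => L1.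
have := comm_step_lcn (f F2_a) (f F2_b) k.
rewrite (comm_step_morph f k (F2_a, F2_b)) -/(comm_word k) /=.
by case: comm_depth L1 => d e /= -> [/set1P].
Qed.

Lemma ltn_comm_length n : (n < (comm_length n).1)%N.
Proof.
suff: (n < (comm_length n).1 /\ 0 < (comm_length n).2)%N by case.
elim: n => //= n; case: comm_length => l s /= [nl s0].
lia.
Qed.

(** * Growth rates of length and depth *)

Section Asymptotics.
Variable R : realType.

(* The growth rates are the leading roots of [t^2 = 3 t + 2] and [t^2 = 2 t + 1]. *)
Definition length_rate : R := (3 + Num.sqrt 17) / 2.
Definition depth_rate : R := 1 + Num.sqrt 2.

Lemma length_rateE : length_rate ^+ 2 = 3 * length_rate + 2.
Proof.
have : Num.sqrt 17 ^+ 2 = 17 :> R by rewrite sqr_sqrtr.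
by rewrite /length_rate => h; field: h.
Qed.

Lemma depth_rateE : depth_rate ^+ 2 = 2 * depth_rate + 1.
Proof.
have : Num.sqrt 2 ^+ 2 = 2 :> R by rewrite sqr_sqrtr.
by rewrite /depth_rate => h; ring: h.
Qed.

Lemma length_rate_ge3 : 3 <= length_rate.
Proof.
suff : 3 <= Num.sqrt 17 :> R by rewrite /length_rate; lra.
have -> : 3 = Num.sqrt (3 ^+ 2) :> R by rewrite sqrtr_sqr ger0_norm.
by rewrite ler_sqrt ?ler0n //; lra.
Qed.

Lemma depth_rate_gt1 : 1 < depth_rate.
Proof. by rewrite /depth_rate ltrDl sqrtr_gt0. Qed.

Lemma comm_length_le n : (comm_length n).1%:R <= 2 * length_rate ^+ n.
Proof.
(* [(1, length_rate - 2)] is an eigenvector of the recursion; the factor 2 covers the start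
   [(1, 2)]. *)
suff: (comm_length n).1%:R <= 2 * length_rate ^+ n /\
      (comm_length n).2%:R <= 2 * (length_rate - 2) * length_rate ^+ n by case.
have r3 := length_rate_ge3.
elim: n => [|n] /=; first by rewrite expr0; split; lra.
case: comm_length => l s /= [ll ls].
have E : length_rate ^+ n * length_rate ^+ 2 =
    length_rate ^+ n * (3 * length_rate + 2) by rewrite length_rateE.
by rewrite !natrD exprSr; split; nra.
Qed.

Lemma comm_depth_ge n : depth_rate ^+ n <= 2 * (comm_depth n).1%:R.
Proof.
(* As [d + e] is the next [d], this bounds two consecutive terms of a recursion with the
   characteristic equation of [depth_rate]. *)
suff: depth_rate ^+ n <= 2 * (comm_depth n).1%:R /\
      depth_rate ^+ n.+1 <= 2 * (comm_depth n).1%:R + 2 * (comm_depth n).2%:R by case.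
elim: n => [|n] /=.
  rewrite expr0 expr1; split; first lra.
  have := depth_rateE; have := depth_rate_gt1; nra.
case: comm_depth => d e /= [ld le].
have E : depth_rate ^+ n.+2 = 2 * depth_rate ^+ n.+1 + depth_rate ^+ n.
  by rewrite -addn2 exprD depth_rateE exprSr; ring.
by rewrite E !natrD; split; lra.
Qed.

(** Subtracting [1 = log2 2] halves [3 + sqrt 17]; the factors [ln 2] cancel. *)
Lemma deltaE : delta R = ln depth_rate / ln length_rate.
Proof.
have ln2 : 0 < ln 2 :> R by rewrite ln_gt0 // ltr1n.
rewrite /delta /log2 /length_rate lnM ?posrE ?invr_gt0 //; last first.
  by rewrite ltr_wpDr ?sqrtr_ge0.
rewrite lnV ?posrE // -[X in _ / (_ - X)](divff (lt0r_neq0 ln2)) -mulrBl.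
by rewrite invfM invrK mulrACA mulVf ?mulr1 ?lt0r_neq0.
Qed.

Lemma delta_gt0 : 0 < delta R.
Proof.
rewrite deltaE divr_gt0 ?ln_gt0 ?depth_rate_gt1 //.
by apply: lt_le_trans length_rate_ge3; rewrite ltr1n.
Qed.

Lemma powR_length_rate k : (length_rate ^+ k) `^ delta R = depth_rate ^+ k.
Proof.
have r3 := length_rate_ge3; have r1 := depth_rate_gt1.
have r0 : 0 <= length_rate by lra.
rewrite -!powR_mulrn ?(le_trans _ (ltW r1)) // -!powRrM mulrC powRrM; congr (_ `^ _).
rewrite deltaE /powR gt_eqF ?divfK ?lnK ?posrE //; [lra | | lra].
by rewrite gt_eqF // ln_gt0 //; lra.
Qed.

End Asymptotics.

Theorem theorem5p1 (R : realType) :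
  preceq (fun n : nat => expR (n%:R `^ delta R))
         (fun n : nat => (Fnil n)%:R).
Proof.
have d0 := delta_gt0 R; have r3 := length_rate_ge3 R.
have ln2 : 0 < ln 2 :> R by rewrite ln_gt0 // ltr1n.
(* [B] absorbs the factor 2 of the depth bound and the change of base from 2 to e. *)
pose B : R := (2 / ln 2) `^ (delta R)^-1.
have B0 : 0 <= B by rewrite powR_ge0.
have Bdelta : B `^ delta R = 2 / ln 2.
  by rewrite -powRrM mulVf ?gt_eqF // powRr1 // divr_ge0 // ltW.
pose K := 2 * length_rate R * (1 + B).
have K0 : 0 < K by rewrite /K; nra.
have KC := archi_boundP (ltW K0); set C := Num.bound K in KC.
have C0 : (0 < C)%N by rewrite -(ltr_nat R) (lt_trans K0).
exists C => // n n0.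
have n1 : 1 <= n%:R :> R by rewrite ler1n.
have [||k lk k_max] := @ex_maxnP (fun k => (comm_length k).1 <= C * n)%N (C * n)%N.
- by exists 0%N; rewrite /= muln_gt0 C0.
- by move=> k; apply: leq_trans; apply/ltnW/ltn_comm_length.
(* Maximality of [k] gives [C n < 2 length_rate^(k+1)], while [C > K > 2 length_rate B]. *)
have Bn : B * n%:R <= length_rate R ^+ k.
  have : ((C * n)%:R : R) < (comm_length k.+1).1%:R.
    rewrite ltr_nat ltnNge; apply/negP => /k_max; by rewrite ltnn.
  move=> /lt_le_trans /(_ (comm_length_le R k.+1)); rewrite natrM exprS => CnL.
  suff : 2 * length_rate R * (B * n%:R) <= 2 * length_rate R * length_rate R ^+ k.
    by rewrite ler_pM2l //; lra.
  have : 2 * length_rate R * B * n%:R <= C%:R * n%:R.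
    by rewrite ler_pM2r ?ltr0n //; move: KC; rewrite /K; nra.
  lra.
have Fk := leq_exp2_Fnil lk.
apply: le_trans (_ : ((2 ^ (comm_depth k).1)%:R : R) <= _); last first.
  apply: le_trans (_ : (Fnil (C * n))%:R <= _); first by rewrite ler_nat.
  by rewrite ler_peMl ?ler0n // ler1n.
rewrite natrX -[X in _ <= X ^+ _]lnK ?posrE // -expRM_natl ler_expR.
have := ge0_ler_powR (ltW d0) _ _ Bn.
rewrite !nnegrE mulr_ge0 ?exprn_ge0 ?ler0n //; last lra.
move=> /(_ isT isT); rewrite powRM // Bdelta powR_length_rate.
move=> /le_trans /(_ (comm_depth_ge R k)).
by rewrite -mulrA ler_pM2l // mulrC ler_pdivrMr.
Qed.
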